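(* Let $p\geqslant1$ and let $f_1,\ldots,f_p:\mathbb{R}^D\to\mathbb{R}^D$ be linear maps. Assume that there exist two subspaces $V,W\subset\mathbb{R}^D$ satisfying $V\oplus W=\mathbb{R}^D$ and, for all $i\in\{1,\ldots,p\}$, (i) $f_i(V)\subset V$ and the linear map $f_{i,V}:V\to V$ induced by $f_i$ is a contraction or the identity map $\mathrm{Id}$, (ii) $f_i(W)\subset W$ and the linear map $f_{i,W}:W\to W$ induced by $f_i$ is a contraction. Then $\big(H^n(K_0)\big)_n$ converges for all $K_0\in\mathcal{K}$ to a set $L$. Precisely: – either there is at least one $i\in\{1,\ldots,p\}$ such that $f_{i,V}=\mathrm{Id}$, and then $L=\mathrm{cl}\big(\bigcup_{n\geqslant0}p_{V,W}(H^n(K_0))\big)$, where $p_{V,W}$ is the projection onto $V$ along $W$; – or else $L=\{0\}$. Moreover, $L$ is the limit of the sequence $\big(H_V^n(p_{V,W}(K_0))\big)_n$, where $H_V$ is the Hutchinson operator associated with the iterated function system $\{f_{1,V},\ldots,f_{p,V}\}$.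
   Context: $D\geqslant1$; $\mathbb{R}^D$ carries the Euclidean norm $\|\cdot\|$; a map is a contraction if its Lipschitz constant (for a linear map, its operator norm induced by $\|\cdot\|$) is $<1$. $\mathcal{K}$ is the set of non-empty compact subsets of $\mathbb{R}^D$, with the Hausdorff metric; convergence of sets is with respect to this metric. $\mathrm{cl}$ denotes closure. The Hutchinson operator associated with maps $g_1,\ldots,g_p$ is $K\mapsto\bigcup_{i=1}^p g_i(K)$; $H$ is the one associated with $\{f_1,\ldots,f_p\}$, so $H(K)=\bigcup_{i=1}^pf_i(K)$. *)

(* Defs.v *)
From HB Require Import structures.
From mathcomp Require Import all_boot all_order all_algebra.
From mathcomp Require Import all_classical all_reals all_analysis.
Import numFieldNormedType.Exports.

Set Implicit Arguments.
Unset Strict Implicit.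
Unset Printing Implicit Defensive.

Import Order.TTheory GRing.Theory Num.Theory.

Local Open Scope classical_set_scope.
Local Open Scope ring_scope.

(* MathComp-Analysis puts the sup norm on 'rV[R]_D; metric notions below go
   through [norm2] instead. The two norms are equivalent, so the library's
   [compact] and [closure] are those of the Euclidean topology. *)
Definition norm2 (R : realType) (D : nat) (x : 'rV[R]_D) : R :=
  Num.sqrt (\sum_(j < D) x 0 j ^+ 2).

(* Extended-real valued, so that no junk value arises on arbitrary sets;
   on non-empty compact sets it is the usual (finite) Hausdorff metric. *)
Definition hausdorff_dist (R : realType) (D : nat) (A B : set 'rV[R]_D) :
    \bar R :=
  Order.max
    (ereal_sup [set ereal_inf [set (norm2 (x - y))%:E | y in B] | x in A])
    (ereal_sup [set ereal_inf [set (norm2 (x - y))%:E | x in A] | y in B]).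

Definition nonempty_compact (R : realType) (D : nat) : set (set 'rV[R]_D) :=
  [set K | K !=set0 /\ compact K].

(* Convergence of a sequence in the metric space of non-empty compact sets:
   the terms and the limit are all required to belong to that space. *)
Definition hausdorff_cvg (R : realType) (D : nat)
    (K : nat -> set 'rV[R]_D) (L : set 'rV[R]_D) : Prop :=
  [/\ forall n, nonempty_compact (K n), nonempty_compact L
    & hausdorff_dist (K n) L @[n --> \oo] --> (0%E : \bar R)].

Definition hutchinson (T : Type) (p : nat) (g : 'I_p -> T -> T) (K : set T) :
    set T :=
  \bigcup_(i in [set: 'I_p]) (g i @` K).

(* Meaningful when f maps V into V: then [vsproj V] only coerces f v, which
   is already in V, to the type of elements of V. *)
Definition induced_end (R : realType) (D : nat) (V : {vspace 'rV[R]_D})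
    (f : 'End('rV[R]_D)) : 'End(subvs_of V) :=
  linfun (vsproj V \o f \o vsval).

Definition opnorm (R : realType) (D : nat) (V : {vspace 'rV[R]_D})
    (g : 'End(subvs_of V)) : \bar R :=
  ereal_sup [set (norm2 (vsval (g v)))%:E |
             v in [set v : subvs_of V | norm2 (vsval v) <= 1]].

Definition linear_contraction (R : realType) (D : nat)
    (V : {vspace 'rV[R]_D}) (g : 'End(subvs_of V)) : Prop :=
  (opnorm g < 1)%E.

Lemma induced_val (F : fieldType) (vT : vectType F) (V : {vspace vT})
    (f : 'End(vT)) (v : subvs_of V) :
  (f @: V <= V)%VS -> vsval (linfun (vsproj V \o f \o vsval) v) = f (vsval v).
Proof.
move=> fV; rewrite lfunE vsprojK //.
exact: subvP fV _ (memv_img f (subvsP v)).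
Qed.

Lemma inducedE (R : realType) (D : nat) (V : {vspace 'rV[R]_D})
    (f : 'End('rV[R]_D)) (v : subvs_of V) :
  (f @: V <= V)%VS -> vsval (induced_end V f v) = f (vsval v).
Proof. exact: induced_val. Qed.

Lemma daddv_pi_along (F : fieldType) (vT : vectType F) (V W : {vspace vT})
    (v w : vT) :
  directv (V + W) -> v \in V -> w \in W -> daddv_pi V W (v + w) = v.
Proof.
move=> /directv_addP VW vV wW.
have WV : (W :&: V = 0)%VS by rewrite capvC.
have := daddv_pi_add VW (subvP (addvSr V W) _ wW).
rewrite (daddv_pi_id WV wW) => h.
have w0 : daddv_pi V W w = 0 by apply: (addIr w); rewrite h add0r.
by rewrite linearD /= (daddv_pi_id VW vV) w0 addr0.
Qed.

(* Main.v *)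
Require Import Defs.
From mathcomp Require Import all_boot all_order all_algebra.
From mathcomp Require Import all_classical all_reals all_analysis.
Import Order.TTheory GRing.Theory Num.Theory.
Import numFieldNormedType.Exports.

Local Open Scope classical_set_scope.
Local Open Scope ring_scope.

(** Let [P] be the projection onto [V] along [W] and [Q] the one onto [W] along
    [V]. Both commute with every [f i], so [x = P x + Q x] splits the dynamics
    into two parts.

    On [W], all the [f i] contract with a common constant [c < 1], because there
    are finitely many of them. Hence [Q x] is at most [c ^+ n * C] in norm for
    every [x] in [H^n K0] ([norm2_iter_hutchinson]): the sets [H^n K0] and
    [A n := P (H^n K0)] become arbitrarily close, and have the same limit
    ([norm_close_image]). Moreover [P] semi-conjugates [H] to [HV]
    ([hutchinson_semiconj]), so that [A n] is also [HV^n (P K0)]. Both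
    convergences therefore amount to that of [A n].

    If some [f i] is the identity on [V], then [A n] is a subset of [A n.+1]. As
    no [f i] increases the norm on [V], the sets [A n] stay in a fixed ball; the
    closure [L] of their union is then compact, and a nondecreasing sequence of
    sets converges to the closure of its union when that closure is compact
    ([nondecreasing_norm_close]).

    Otherwise all the [f i] contract on [V] too, and the decay used for [Q] also
    applies to [P]: the sets [A n] shrink to the origin. *)

Set Implicit Arguments.
Unset Strict Implicit.
Unset Printing Implicit Defensive.

(** * Euclidean norm and topology of row vectors *)

Lemma lfun_rV_continuous (R : realType) (m n : nat)
  (f : 'Hom('rV[R]_m, 'rV[R]_n)) : continuous f.
Proof.
(* a linear map is a finite combination of the continuous coordinates *)
have fE : (f : _ -> _) = fun x : 'rV[R]_m =>
    \sum_(j < m) x ord0 j *: f (delta_mx ord0 j).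
  apply/funext => x; rewrite {1}(row_sum_delta x) linear_sum.
  by apply: eq_bigr => j _; rewrite linearZ.
rewrite fE; elim: (index_enum _) => [|j s IH].
  under eq_fun do rewrite big_nil.
  exact: cst_continuous.
under eq_fun do rewrite big_cons.
move=> x; apply: (@continuousD R _ 'rV[R]_m
  (fun y => y ord0 j *: f (delta_mx ord0 j)) _ x _ (IH x)).
apply: (@continuousZ R 'rV[R]_n 'rV[R]_m); last exact: cst_continuous.
exact: coord_continuous.
Qed.

Lemma norm2_ge0 (R : realType) (D : nat) (x : 'rV[R]_D) : 0 <= norm2 x.
Proof. exact: sqrtr_ge0. Qed.

Lemma norm2_0 (R : realType) (D : nat) : norm2 (0 : 'rV[R]_D) = 0.
Proof.
rewrite /norm2 big1 ?sqrtr0 // => j _.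
by rewrite mxE expr0n.
Qed.

Lemma norm2Z (R : realType) (D : nat) (a : R) (x : 'rV[R]_D) :
  norm2 (a *: x) = `|a| * norm2 x.
Proof.
rewrite /norm2 -sqrtr_sqr -sqrtrM ?sqr_ge0 // mulr_sumr.
by congr (Num.sqrt _); apply: eq_bigr => j _; rewrite mxE exprMn.
Qed.

Lemma norm_le_norm2 (R : realType) (D : nat) (x : 'rV[R]_D) :
  `|x| <= norm2 x.
Proof.
rewrite [`|x|]mx_normrE; apply: bigmax_le; first exact: norm2_ge0.
move=> [i j] _ /=; rewrite (ord1 i) -sqrtr_sqr ler_wsqrtr //.
by rewrite (bigD1 j) //= lerDl sumr_ge0 // => k _; exact: sqr_ge0.
Qed.

Lemma norm2_le_norm (R : realType) (D : nat) (x : 'rV[R]_D) :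
  norm2 x <= Num.sqrt D%:R * `|x|.
Proof.
rewrite -[`|x|]ger0_norm // -sqrtr_sqr -sqrtrM ?ler0n // ler_wsqrtr //.
rewrite mulr_natl -[X in _ *+ X]card_ord -sumr_const ler_sum // => j _.
rewrite -real_normK ?num_real // lerXn2r ?nnegrE //.
rewrite [leRHS]mx_normrE.
exact: (le_bigmax 0 (fun ij => `|x ij.1 ij.2|) (0, j)).
Qed.

Lemma norm2_eq0 (R : realType) (D : nat) (x : 'rV[R]_D) :
  norm2 x = 0 -> x = 0.
Proof.
by move=> x0; apply/eqP; rewrite -normr_le0 -x0 norm_le_norm2.
Qed.

Lemma near_geometric_le (R : realType) (c C e : R) : 0 <= c -> c < 1 -> 0 < e ->
  \forall n \near \oo, c ^+ n * C <= e.
Proof.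
move=> c0 c1 e0.
have cC : (fun n => c ^+ n * C) @ \oo --> (0 * C : R).
  by apply: cvgM; [apply: cvg_expr; rewrite ger0_norm|exact: cvg_cst].
move: cC; rewrite mul0r => /cvgrPdist_le /(_ e e0).
apply: filterS => n; rewrite sub0r normrN.
exact: le_trans (ler_norm _).
Qed.

(** * Hausdorff convergence through the ambient norm *)

(** Closeness up to [e] in the Hausdorff distance of the ambient norm. On row
    vectors this is the sup norm, which comes with the triangle inequality and
    the balls of the topology; being equivalent to [norm2], it gives the same
    convergent sequences of sets. *)
Definition norm_close (R : realType) (U : normedModType R) (e : R)
    (A B : set U) : Prop :=
  (forall x, A x -> exists2 y, B y & `|x - y| <= e) /\
  (forall y, B y -> exists2 x, A x & `|x - y| <= e).

Lemma hausdorff_dist_ge0 (R : realType) (D : nat) (A B : set 'rV[R]_D) :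
  A !=set0 -> (0 <= hausdorff_dist A B)%E.
Proof.
move=> [a Aa]; rewrite /hausdorff_dist le_max; apply/orP; left.
apply: (@le_trans _ _ (ereal_inf [set (norm2 (a - y))%:E | y in B])).
  by apply: le_ereal_inf_tmp => _ [y _ <-]; rewrite lee_fin norm2_ge0.
by apply: ereal_sup_ubound; exists a.
Qed.

Lemma hausdorff_dist_le (R : realType) (D : nat) (e : R)
    (A B : set 'rV[R]_D) :
  norm_close e A B -> (hausdorff_dist A B <= (Num.sqrt D%:R * e)%:E)%E.
Proof.
have le2 (x y : 'rV[R]_D) : `|x - y| <= e ->
    ((norm2 (x - y))%:E <= (Num.sqrt D%:R * e)%:E)%E.
  move=> xy; rewrite lee_fin; apply: le_trans (norm2_le_norm _) _.
  by rewrite ler_wpM2l ?sqrtr_ge0.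
move=> [AB BA]; rewrite /hausdorff_dist ge_max; apply/andP; split.
  apply: ge_ereal_sup => _ [x Ax <-]; have [y By xy] := AB x Ax.
  by apply: ge_ereal_inf; exists (norm2 (x - y))%:E; [exists y|exact: le2].
apply: ge_ereal_sup => _ [y By <-]; have [x Ax xy] := BA y By.
by apply: ge_ereal_inf; exists (norm2 (x - y))%:E; [exists x|exact: le2].
Qed.

Lemma hausdorff_cvg_of_norm_close (R : realType) (D : nat)
    (K : nat -> set 'rV[R]_D) (L : set 'rV[R]_D) :
  (forall n, nonempty_compact (K n)) -> nonempty_compact L ->
  (forall e, 0 < e -> \forall n \near \oo, norm_close e (K n) L) ->
  hausdorff_cvg K L.
Proof.
move=> Kc Lc close; split=> //.
have small e : 0 < e -> \forall n \near \oo,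
    (0 <= hausdorff_dist (K n) L <= e%:E)%E.
  (* [+ 1] keeps the divisor positive when [D] is zero *)
  move=> e0; have d0 : 0 < Num.sqrt (D%:R : R) + 1.
    by rewrite ltr_wpDl // sqrtr_ge0.
  near=> n; rewrite (hausdorff_dist_ge0 _ (proj1 (Kc n))) /=.
  have /hausdorff_dist_le/le_trans :
      norm_close (e / (Num.sqrt D%:R + 1)) (K n) L.
    by near: n; apply: close; rewrite divr_gt0.
  apply; rewrite lee_fin mulrCA ger_pMr // ler_pdivrMr // mul1r lerDl //.
apply/fine_cvgP; split.
  near=> n; have /andP[h0 h1] : (0 <= hausdorff_dist (K n) L <= 1%:E)%E.
    by near: n; exact: small.
  by rewrite ge0_fin_numE // (le_lt_trans h1) ?ltry.
apply/cvgrPdist_le => e e0; near=> n.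
have /andP[h0 h1] : (0 <= hausdorff_dist (K n) L <= e%:E)%E.
  by near: n; exact: small.
rewrite sub0r normrN ger0_norm ?fine_ge0 //=.
by rewrite -lee_fin fineK // ge0_fin_numE // (le_lt_trans h1) ?ltry.
Unshelve. all: by end_near. Qed.

Lemma norm_close_image (R : realType) (U : normedModType R) (g : U -> U)
    (K L : set U) (d e : R) :
  (forall x, K x -> `|x - g x| <= d) -> norm_close e (g @` K) L ->
  norm_close (d + e) K L.
Proof.
move=> gd [KL LK].
have tri x y : K x -> `|g x - y| <= e -> `|x - y| <= d + e.
  move=> Kx gy; rewrite -(subrK (g x) x) -addrA.
  by rewrite (le_trans (ler_normD _ _)) // lerD // gd.
split=> [x Kx|y Ly].
  have [y Ly gy] := KL (g x) (ex_intro2 _ _ x Kx erefl).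
  by exists y => //; exact: tri.
have [_ [x Kx <-] gy] := LK y Ly.
by exists x => //; exact: tri.
Qed.

(** Every point of the closure of the union has a neighbourhood all of whose
    points are within [e] of the sets [A n], for [n] large; compactness makes
    the rank uniform over the closure. *)
Lemma nondecreasing_norm_close (R : realType) (U : normedModType R)
    (A : nat -> set U) :
  (forall m n, (m <= n)%N -> A m `<=` A n) ->
  compact (closure (\bigcup_n A n)) ->
  forall e, 0 < e ->
    \forall n \near \oo, norm_close e (A n) (closure (\bigcup_n A n)).
Proof.
move=> Amono /compact_near_coveringP Lcov e e0.
have := Lcov nat \oo (fun n y => exists2 x, A n x & `|x - y| <= e) _ _.
case; last first.
  move=> N _ AL; exists N => // n Nn; split; last exact: AL.
  move=> x Anx; exists x; last by rewrite subrr normr0 ltW.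
  by apply: subset_closure; exists n.
move=> y Ly; have e20 : 0 < e / 2 by rewrite divr_gt0.
have [x [[N _ ANx] yx]] := Ly _ (nbhsx_ballx y (e / 2) e20).
exists (ball y (e / 2), [set n | (N <= n)%N]).
  by split; [exact: nbhsx_ballx|exists N].
move=> [y' n] /= [yy' Nn]; exists x; first exact: Amono Nn _ ANx.
apply: ltW; rewrite (splitr e).
rewrite -ball_normE /= in yx yy'.
rewrite (_ : x - y' = (x - y) + (y - y')); last by rewrite addrA subrK.
by apply: le_lt_trans (ler_normD _ _) _; rewrite ltrD // distrC.
Qed.

(** * Iterates of Hutchinson operators *)

Lemma hutchinson_nonempty_compact (R : realType) (D p : nat)
    (f : 'I_p -> 'End('rV[R]_D)) (K : set 'rV[R]_D) : (0 < p)%N ->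
  nonempty_compact K -> nonempty_compact (hutchinson (fun i => f i : _ -> _) K).
Proof.
move=> p0 [[x Kx] Kc]; split.
  by exists (f (Ordinal p0) x), (Ordinal p0) => //; exists x.
rewrite /hutchinson.
have -> : [set: 'I_p] = [set` enum 'I_p].
  by apply/seteqP; split => i //= _; rewrite mem_enum.
rewrite bigcup_seq; apply: bigsetU_compact => i _.
apply: continuous_compact => //.
exact/continuous_subspaceT/lfun_rV_continuous.
Qed.

Lemma iter_nonempty_compact (R : realType) (D p : nat)
    (f : 'I_p -> 'End('rV[R]_D)) (K : set 'rV[R]_D) n : (0 < p)%N ->
  nonempty_compact K ->
  nonempty_compact (iter n (hutchinson (fun i => f i : _ -> _)) K).
Proof.
by move=> p0 K0; elim: n => // n IH; exact: hutchinson_nonempty_compact.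
Qed.

Lemma hutchinson_semiconj (T U : Type) (p : nat) (f : 'I_p -> T -> T)
    (g : 'I_p -> U -> U) (phi : T -> U) :
  (forall i x, phi (f i x) = g i (phi x)) ->
  forall n K, phi @` iter n (hutchinson f) K
            = iter n (hutchinson g) (phi @` K).
Proof.
move=> fg n K; elim: n => //= n <-; rewrite /hutchinson image_bigcup.
apply: eq_bigcupr => i _; rewrite !image_comp.
by apply: eq_imagel => x _; exact: fg.
Qed.

(** Used with [P] a projection that commutes with the [f i]: only the component
    selected by [P] has to be controlled. *)
Lemma norm2_iter_hutchinson (R : realType) (D p : nat)
    (f : 'I_p -> 'End('rV[R]_D)) (P : 'rV[R]_D -> 'rV[R]_D) (c C : R) K :
  0 <= c ->
  (forall i x, norm2 (P (f i x)) <= c * norm2 (P x)) ->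
  (forall x, K x -> norm2 (P x) <= C) ->
  forall n x, iter n (hutchinson (fun i => f i : _ -> _)) K x ->
    norm2 (P x) <= c ^+ n * C.
Proof.
move=> c0 fc KC; elim=> [|n IH] x; first by rewrite mul1r; exact: KC.
rewrite iterS => -[i _ [y /IH yC <-]].
by rewrite exprS -mulrA (le_trans (fc i y)) // ler_wpM2l.
Qed.

Lemma compact_norm2_bounded (R : realType) (D : nat) (K : set 'rV[R]_D)
    (P : 'End('rV[R]_D)) : compact K ->
  exists C, forall x, K x -> norm2 (P x) <= C.
Proof.
move=> Kc; have : bounded_set [set P x | x in K].
  apply: compact_bounded; apply: continuous_compact => //.
  exact/continuous_subspaceT/lfun_rV_continuous.
move=> [M [_ /(_ (M + 1))]]; rewrite ltrDl => /(_ ltr01).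
move: (M + 1) => {}M hM.
exists (Num.sqrt D%:R * M) => x Kx.
apply: le_trans (norm2_le_norm _) _; rewrite ler_wpM2l ?sqrtr_ge0 //.
by apply: hM; exists x.
Qed.

(** * Linear maps preserving a subspace *)

(** The operator norm itself is the constant: it bounds [norm2 (f v)] on the
    unit ball of [V], and homogeneity extends the bound to [V]. *)
Lemma norm2_le_contraction (R : realType) (D : nat) (V : {vspace 'rV[R]_D})
    (f : 'End('rV[R]_D)) :
  (f @: V <= V)%VS -> linear_contraction (induced_end V f) ->
  exists c, [/\ 0 <= c, c < 1 &
    forall v, v \in V -> norm2 (f v) <= c * norm2 v].
Proof.
move=> fV; rewrite /linear_contraction; set s := opnorm _ => s1.
have ub v : v \in V -> norm2 v <= 1 -> ((norm2 (f v))%:E <= s)%E.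
  move=> vV v1; apply: ereal_sup_ubound; exists (vsproj V v).
    by rewrite /= vsprojK.
  by rewrite inducedE // vsprojK.
have s0 : (0 <= s)%E.
  by have := ub 0 (mem0v V); rewrite linear0 norm2_0; apply; rewrite ler01.
have sfin : s \is a fin_num by rewrite ge0_fin_numE // (lt_trans s1) ?ltry.
exists (fine s); split; first exact: fine_ge0.
  by rewrite -lte_fin fineK.
move=> v vV; have [/norm2_eq0 ->|v0] := eqVneq (norm2 v) 0.
  by rewrite linear0 norm2_0 mulr0.
have v_gt0 : 0 < norm2 v by rewrite lt_neqAle eq_sym v0 norm2_ge0.
have := ub ((norm2 v)^-1 *: v) (memvZ _ vV).
rewrite linearZ /= !norm2Z ger0_norm ?invr_ge0 ?norm2_ge0 // mulVf // lexx.
move=> /(_ isT).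
by rewrite -[s]fineK // lee_fin mulrC ler_pdivrMr.
Qed.

Lemma uniform_contraction (R : realType) (D p : nat) (V : {vspace 'rV[R]_D})
    (f : 'I_p -> 'End('rV[R]_D)) :
  (forall i, (f i @: V <= V)%VS /\ linear_contraction (induced_end V (f i))) ->
  exists c, [/\ 0 <= c, c < 1 &
    forall i v, v \in V -> norm2 (f i v) <= c * norm2 v].
Proof.
move=> fV.
have /choice[c_ hc] i := norm2_le_contraction (proj1 (fV i)) (proj2 (fV i)).
exists (\big[Num.max/0]_i c_ i); split.
- exact: bigmax_ge_id.
- by apply: bigmax_lt => // i _; have [] := hc i.
- move=> i v vV; have [_ _ /(_ v vV)/le_trans] := hc i; apply.
  by rewrite ler_wpM2r ?norm2_ge0 // le_bigmax.
Qed.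

Lemma induced_end_id (R : realType) (D : nat) (V : {vspace 'rV[R]_D})
    (f : 'End('rV[R]_D)) (v : 'rV[R]_D) :
  (f @: V <= V)%VS -> induced_end V f = \1%VF -> v \in V -> f v = v.
Proof.
move=> fV f1 vV; rewrite -[in LHS](vsprojK vV) -inducedE // f1 id_lfunE.
exact: vsprojK.
Qed.

Lemma daddv_pi_lfun (F : fieldType) (vT : vectType F) (V W : {vspace vT})
    (f : 'End(vT)) (x : vT) :
  directv (V + W) -> (V + W)%VS = fullv ->
  (f @: V <= V)%VS -> (f @: W <= W)%VS ->
  daddv_pi V W (f x) = f (daddv_pi V W x).
Proof.
move=> VW full fV fW.
have VW0 : (V :&: W = 0)%VS by exact/directv_addP.
have xVW : x \in (V + W)%VS by rewrite full memvf.
rewrite -{1}(daddv_pi_add VW0 xVW) linearD.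
by apply: daddv_pi_along => //;
  [apply: (subvP fV)|apply: (subvP fW)]; exact: memv_img (memv_pi _ _ _).
Qed.

Unset Implicit Arguments.

(** * Convergence of the iterates *)

Theorem theorem3p6 (R : realType) (D : nat) (hD : (1 <= D)%N)
    (p : nat) (hp : (1 <= p)%N) (f : 'I_p -> 'End('rV[R]_D))
    (V W : {vspace 'rV[R]_D})
    (hdirect : directv (V + W)) (hfull : (V + W)%VS = fullv)
    (hV : forall i, (f i @: V <= V)%VS /\
       (linear_contraction (induced_end V (f i)) \/ induced_end V (f i) = \1%VF))
    (hW : forall i, (f i @: W <= W)%VS /\
       linear_contraction (induced_end W (f i)))
    (K0 : set 'rV[R]_D) (hK0 : nonempty_compact K0) :
  let H := hutchinson (fun i => f i : 'rV[R]_D -> 'rV[R]_D) in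
  let HV := hutchinson (fun i => induced_end V (f i) : subvs_of V -> subvs_of V) in
  let pVW : 'rV[R]_D -> 'rV[R]_D := daddv_pi V W in
  exists L : set 'rV[R]_D,
    [/\ hausdorff_cvg (fun n => iter n H K0) L,
        ((exists i, induced_end V (f i) = \1%VF) /\
           L = closure (\bigcup_n (pVW @` iter n H K0)))
        \/ (~ (exists i, induced_end V (f i) = \1%VF) /\ L = [set 0])
      & hausdorff_cvg
          (fun n => vsval @` iter n HV ((vsproj V \o pVW) @` K0)) L].
Proof.
move=> H HV P.
pose Q : 'End('rV[R]_D) := daddv_pi W V.
have VW0 : (V :&: W = 0)%VS by exact/directv_addP.
have PQ x : P x + Q x = x by apply: daddv_pi_add; rewrite ?hfull ?memvf.
have fP i x : P (f i x) = f i (P x).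
  by apply: daddv_pi_lfun => //; [case: (hV i)|case: (hW i)].
have fQ i x : Q (f i x) = f i (Q x).
  apply: daddv_pi_lfun; rewrite 1?addvC //; last by case: (hV i).
    by apply/directv_addP; rewrite capvC.
  by case: (hW i).
pose A n := P @` iter n H K0.
have Hc n : nonempty_compact (iter n H K0) by exact: iter_nonempty_compact.
have Ac n : nonempty_compact (A n).
  have [[x Hx] Hcpt] := Hc n; split; first by exists (P x), x.
  by apply: continuous_compact => //;
    apply/continuous_subspaceT/lfun_rV_continuous.
have AE n : vsval @` iter n HV ((vsproj V \o P) @` K0) = A n.
  rewrite -(@hutchinson_semiconj _ _ _ (fun i => f i : _ -> _)).
    rewrite image_comp; apply: eq_imagel => x _ /=.
    by rewrite vsprojK // memv_pi.
  move=> i x; apply: val_inj => /=; rewrite fP.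
  have [fV _] := hV i; rewrite inducedE // !vsprojK ?memv_pi //.
  by apply: (subvP fV); exact: memv_img (memv_pi _ _ _).
have [c [c0 c1 cW]] := uniform_contraction hW.
have [C QC] := compact_norm2_bounded Q (proj2 hK0).
have Qsmall n x : iter n H K0 x -> norm2 (Q x) <= c ^+ n * C.
  apply: norm2_iter_hutchinson => // i y.
  by rewrite fQ cW // memv_pi.
(* a point of [H^n K0] differs from its projection by its [W]-component only,
   which [Qsmall] makes uniformly small *)
have reduce L : nonempty_compact L ->
    (forall e, 0 < e -> \forall n \near \oo, norm_close e (A n) L) ->
    hausdorff_cvg (fun n => iter n H K0) L /\
    hausdorff_cvg (fun n => vsval @` iter n HV ((vsproj V \o P) @` K0)) L.
  move=> Lc AL; split; last first.
    apply: hausdorff_cvg_of_norm_close => // [n|e e0]; first by rewrite AE.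
    by near do rewrite AE; exact: AL.
  apply: hausdorff_cvg_of_norm_close => // e e0.
  have e20 : 0 < e / 2 by rewrite divr_gt0.
  near=> n; rewrite (splitr e); apply: (@norm_close_image _ _ P).
    move=> x Hx; rewrite -{1}(PQ x) addrAC subrr add0r.
    rewrite (le_trans (norm_le_norm2 _)) // (le_trans (Qsmall n x Hx)) //.
    by near: n; exact: near_geometric_le.
  by near: n; exact: AL.
have [C' PC] := compact_norm2_bounded (daddv_pi V W) (proj2 hK0).
have [hid|hnid] := pselect (exists i, induced_end V (f i) = \1%VF).
  pose L := closure (\bigcup_n A n).
  have Amono m n : (m <= n)%N -> A m `<=` A n.
    move=> mn; rewrite -(subnK mn); elim: (n - m)%N => // k IH y /IH.
    rewrite addSn => -[x Hx <-]; have [i fi] := hid.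
    exists (f i x); first by exists i => //; exists x.
    by rewrite fP (induced_end_id _ fi) ?memv_pi //; case: (hV i).
  have f1 i v : v \in V -> norm2 (f i v) <= norm2 v.
    move=> vV; have [fV [fc|fid]] := hV i; last first.
      by rewrite (induced_end_id _ fid).
    have [d [d0 d1 /(_ v vV)/le_trans]] := norm2_le_contraction fV fc; apply.
    by rewrite ler_piMl ?norm2_ge0 // ltW.
  have LC : nonempty_compact L.
    split.
      have [x Ax] := proj1 (Ac 0%N).
      by exists x; apply: subset_closure; exists 0%N.
    apply: bounded_closed_compact; last exact: closed_closure.
    exists C'; split; first exact: num_real.
    move=> M /ltW CM y Ly /=; apply: le_trans CM.
    suff: closed_ball_ (fun x => `|x|) (0 : 'rV[R]_D) C' y.
      by rewrite /closed_ball_ /= sub0r normrN.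
    (* the closed ball of radius [C'] contains each [A n], hence the closure *)
    have clB := @closed_closed_ball_ R 'rV[R]_D 0 C'.
    apply: clB; apply: closureS Ly => _ [n _ [x Hx <-]].
    rewrite /closed_ball_ /= sub0r normrN (le_trans (norm_le_norm2 _)) //.
    have := @norm2_iter_hutchinson _ _ _ f P 1 C' K0 ler01 _ PC n x Hx.
    by rewrite expr1n mul1r; apply => i z; rewrite fP mul1r f1 // memv_pi.
  have [h1 h2] := reduce L LC (nondecreasing_norm_close Amono (proj2 LC)).
  by exists L; split => //; left.
have hVc i : (f i @: V <= V)%VS /\ linear_contraction (induced_end V (f i)).
  have [fV [//|fid]] := hV i; by exfalso; apply: hnid; exists i.
have [d [d0 d1 dV]] := uniform_contraction hVc.
have Psmall n x : iter n H K0 x -> norm2 (P x) <= d ^+ n * C'.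
  by apply: norm2_iter_hutchinson => // i y; rewrite fP dV // memv_pi.
have [||h1 h2] := reduce [set 0].
- by split; [exists 0|exact: compact_set1].
- move=> e e0.
  have small : \forall n \near \oo, d ^+ n * C' <= e.
    exact: near_geometric_le.
  near=> n; have Ae x : A n x -> `|x - 0| <= e.
    move=> [y Hy <-]; rewrite subr0 (le_trans (norm_le_norm2 _)) //.
    by rewrite (le_trans (Psmall n y Hy)) //; near: n.
  split=> [x Ax|_ ->]; first by exists 0 => //; exact: Ae.
  by have [x Ax] := proj1 (Ac n); exists x => //; exact: Ae.
by exists [set 0]; split => //; right.
Unshelve. all: by end_near. Qed.
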